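(* Let $(f(n))_{n\in\mathbb{N}}$ be any sequence of integers having property $\mathrm{D}_0$, i.e. $f(1)=0$ and $f(n+1)-f(n)\in\{0,1\}$ for all $n\in\mathbb{N}$. Then the corresponding sequence $(q(n))_{n\in\mathbb{N}}$, with $q(1)=1$ and with $q(n)$ for $n>1$ computed recursively from $$q(n)=q(n-q(n-1))+f(n),$$ exists for all $n\in\mathbb{N}$.
   Context: Here $\mathbb{N}=\{1,2,3,\dots\}$ and all sequences start at index $1$. The sequence $q$ has no values at indices $\le 0$, so $q(n)$ can be computed from the recursion only if $n-q(n-1)$ lies in $\{1,\dots,n-1\}$. The sequence $q$ is said to exist (for all $n\in\mathbb{N}$) if $q(n)$ is defined by the recursion for every $n\in\mathbb{N}$; equivalently, if $1\le q(n)\le n$ for all $n\in\mathbb{N}$. *)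

(* Defs.v *)
From mathcomp Require Import all_boot all_order all_algebra.

Set Implicit Arguments.
Unset Strict Implicit.
Unset Printing Implicit Defensive.

Import GRing.Theory.
Local Open Scope ring_scope.

(* Sequences indexed by {1, 2, 3, ...} are functions on nat whose value at 0
   is never used. *)
Definition property_D0 (f : nat -> int) : Prop :=
  f 1%N = 0 /\
  forall n : nat, (1 <= n)%N -> f n.+1 - f n = 0 \/ f n.+1 - f n = 1.

(* [q_value f n v]: the recursion q(1) = 1, q(n) = q(n - q(n-1)) + f(n) yields
   the value v at n.  As q may fail to exist, it is defined as a partial
   function, by its graph: the step to n + 1 is possible only if q(n) is defined
   and the index j = (n + 1) - q(n), computed in int, lies in {1, ..., n}. *)
Inductive q_value (f : nat -> int) : nat -> int -> Prop :=
| q_value1 : q_value f 1%N 1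
| q_valueS (n j : nat) (p r : int) :
    (1 <= n)%N -> q_value f n p ->
    j%:Z = n.+1%:Z - p -> (1 <= j <= n)%N -> q_value f j r ->
    q_value f n.+1 (r + f n.+1).

Definition q_exists (f : nat -> int) : Prop :=
  forall n : nat, (1 <= n)%N -> exists v : int, q_value f n v.

Lemma q_value_functional (f : nat -> int) (n : nat) (v w : int) :
  q_value f n v -> q_value f n w -> v = w.
Proof.
move=> Hv; elim: Hv w => [w Hw|{}n j p r n_gt0 _ IHp Dj _ _ IHr w Hw].
  by inversion Hw; subst.
inversion Hw as [|n' j' p' r' _ Hp' Dj' _ Hr']; subst => //.
have Epp := IHp _ Hp'; rewrite -Epp -Dj in Dj'.
by case: Dj' => Ej; rewrite Ej in Hr'; rewrite (IHr _ Hr').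
Qed.

(* Main.v *)
(* The invariant is f(n) + 1 <= q(n) <= n.  With j = n + 1 - q(n), the lower
   bound at n + 1 holds since q(j) >= 1, and the upper bound since
   q(j) <= j = n + 1 - q(n) and f(n+1) <= f(n) + 1 <= q(n). *)
Require Import Defs.
From mathcomp Require Import all_boot all_order all_algebra.
From mathcomp Require Import zify.

Local Open Scope ring_scope.

Lemma property_D0_ge0 (f : nat -> int) (n : nat) :
  property_D0 f -> (1 <= n)%N -> 0 <= f n.
Proof.
case=> f1 fS; elim: n => // -[|n] IHn _; first by rewrite f1.
by have [//|fSn|fSn] := fS n.+1; have := IHn isT; lia.
Qed.

Lemma q_value_bounded (f : nat -> int) (n : nat) :
  property_D0 f -> (1 <= n)%N ->
  exists v : int, q_value f n v /\ f n + 1 <= v <= n%:Z.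
Proof.
move=> hf; elim/ltn_ind: n => -[|[|n]] IH // _.
  by exists 1; split; [exact: q_value1 | rewrite (proj1 hf)].
have [//|//|p [qp /andP[lep pn]]] := IH n.+1.
(* With [lep] this gives [1 <= p], hence [j <= n.+1] below; [pn] gives [1 <= j]. *)
have fn0 : 0 <= f n.+1 by apply: property_D0_ge0.
have [j Dj] : exists j : nat, j%:Z = n.+2%:Z - p.
  (* The absolute value changes nothing, since [p <= n.+1] makes the difference positive. *)
  by exists `|n.+2%:Z - p|%N; lia.
have jn : (1 <= j <= n.+1)%N by lia.
have [||r [qr /andP[ler rj]]] := IH j; [lia | lia |].
exists (r + f n.+2); split; first exact: (q_valueS (n := n.+1) (p := p) (j := j)).
(* Turns [ler] into [1 <= r], which is all that the lower bound at [n.+2] needs; the bound on the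
   increment of [f] serves the upper one. *)
have fj0 : 0 <= f j by apply: property_D0_ge0 => //; lia.
by case: (proj2 hf n.+1 isT) => fS; lia.
Qed.

Theorem theorem1p3 (f : nat -> int) (hf : property_D0 f) : q_exists f.
Proof.
by move=> n n_gt0; have [v [qv _]] := @q_value_bounded f n hf n_gt0; exists v.
Qed.
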